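(* Let $k$ be a field of characteristic $0$, $n\ge1$, $A=k[x_1,\dots,x_n]$, $X=\{x_1,\dots,x_n\}$, and let $P_n=A\otimes_k kX$ be the perm algebra with product $$(u\times x_r)\cdot(v\times x_s):=(uvx_r)\times x_s,$$ where $u\times x_j$ denotes $u\otimes x_j$. For $i\in\{1,\dots,n\}$ let $D_i:P_n\to P_n$ be the $k$-linear map $$D_i(u\times x_j)=\bigl(x_i\,\partial_i(u)\bigr)\times x_j+\delta_{ij}\,u\times x_i,\qquad \partial_i=\frac{\partial}{\partial x_i},$$ and set $W_{\mathrm{perm}}(n):=\bigoplus_{i=1}^n P_nD_i$. Then the bilinear bracket $$[aD_i,\,bD_j]:=\bigl(a\cdot D_i(b)\bigr)D_j-\bigl(b\cdot D_j(a)\bigr)D_i,\qquad a,b\in P_n,\ i,j\in\{1,\dots,n\},$$ turns $W_{\mathrm{perm}}(n)$ into a Lie algebra.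
   Context: A perm algebra is an associative algebra satisfying $(ab)c=(ba)c$. $kX$ is the $k$-vector space with basis $X$, and $\delta_{ij}$ is the Kronecker delta. The space $\bigoplus_{i=1}^n P_nD_i$ is the formal direct sum of $n$ copies of $P_n$, where $aD_i$ denotes the element $a\in P_n$ placed in the $i$-th copy. *)

(* Defs.v *)
From mathcomp Require Import all_boot all_algebra.
From mathcomp Require Import mpoly.

Set Implicit Arguments.
Unset Strict Implicit.
Unset Printing Implicit Defensive.

Import GRing.Theory.
Local Open Scope ring_scope.

(* [br] makes [L] a Lie algebra over [k]; [alternating] (rather than
   antisymmetry) is the usual definition over an arbitrary field. *)
Record is_lie_bracket (k : fieldType) (L : lmodType k) (br : L -> L -> L) :
    Prop := IsLieBracket {
  lie_linearl : forall v, linear (br^~ v);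
  lie_linearr : forall u, linear (br u);
  lie_alternating : forall u, br u u = 0;
  lie_jacobi : forall u v w,
    br u (br v w) + br v (br w u) + br w (br u v) = 0
}.

(* A (x) kX, with A = k[x_1..x_n], is the free A-module on X: a tensor
   \sum_j u_j (x) x_j is encoded by the finite function j |-> u_j. *)
Notation perm_space k n := {ffun 'I_n -> {mpoly k[n]}}.

(* The formal direct sum of the P_n D_i; the value at i is the coefficient
   of D_i. *)
Notation Wperm k n := {ffun 'I_n -> perm_space k n}.

Section PermAlgebra.

Variables (k : fieldType) (n : nat).

Implicit Types (u v : {mpoly k[n]}) (a b c : perm_space k n).

Definition ptens u (j : 'I_n) : perm_space k n :=
  [ffun l => if l == j then u else 0].

(* Bilinear extension of (u x x_r) . (v x x_s) = (u v x_r) x x_s. *)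
Definition pmul a b : perm_space k n :=
  \sum_(r < n) \sum_(s < n) ptens (a r * b s * 'X_r) s.

(* Linear extension of
   D_i (u x x_j) = (x_i d_i u) x x_j + delta_ij (u x x_i). *)
Definition pD (i : 'I_n) a : perm_space k n :=
  \sum_(j < n) (ptens ('X_i * mderiv i (a j)) j
                + (i == j)%:R *: ptens (a j) i).

(* The element a D_i. *)
Definition Wgen a (i : 'I_n) : Wperm k n :=
  [ffun l => if l == i then a else 0].

(* Bilinear extension of
   [a D_i, b D_j] = (a . D_i b) D_j - (b . D_j a) D_i. *)
Definition Wbracket (x y : Wperm k n) : Wperm k n :=
  \sum_(i < n) \sum_(j < n)
    (Wgen (pmul (x i) (pD i (y j))) j - Wgen (pmul (y j) (pD j (x i))) i).

Lemma ptensE u j l : ptens u j l = if l == j then u else 0.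
Proof. exact: ffunE. Qed.

Lemma WgenE a i l : Wgen a i l = if l == i then a else 0.
Proof. exact: ffunE. Qed.

Lemma pscaleE (e : k) a l : (e *: a) l = e *: a l.
Proof. exact: ffunE. Qed.

Lemma paddE a b l : (a + b) l = a l + b l.
Proof. exact: ffunE. Qed.

Lemma pzeroE l : (0 : perm_space k n) l = 0.
Proof. exact: ffunE. Qed.

Lemma ptens0 j : ptens 0 j = 0.
Proof. by apply/ffunP=> l; rewrite ptensE pzeroE; case: ifP. Qed.

Lemma Wgen0 i : Wgen 0 i = 0.
Proof.
apply/ffunP=> l; rewrite WgenE.
by transitivity (0 : perm_space k n); [case: ifP | rewrite ffunE].
Qed.

Lemma ptens_sum a : a = \sum_(j < n) ptens (a j) j.
Proof.
apply/ffunP=> l; rewrite sum_ffunE (bigD1 l) //= ptensE eqxx.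
rewrite big1 ?addr0 // => j jNl.
by rewrite ptensE eq_sym (negbTE jNl).
Qed.

Lemma pmulE a b s : pmul a b s = (\sum_(r < n) a r * 'X_r) * b s.
Proof.
rewrite /pmul sum_ffunE mulr_suml; apply: eq_bigr => r _.
rewrite sum_ffunE (bigD1 s) //= ptensE eqxx big1 ?addr0 => [|j jNs].
  by rewrite mulrAC.
by rewrite ptensE eq_sym (negbTE jNs).
Qed.

Lemma pDE i a j : pD i a j = 'X_i * mderiv i (a j) + (i == j)%:R *: a j.
Proof.
rewrite /pD sum_ffunE (bigD1 j) //= big1 => [|l lNj].
  rewrite addr0 paddE pscaleE !ptensE eqxx eq_sym.
  by case: eqP => // _; rewrite !scale0r.
rewrite paddE pscaleE !ptensE eq_sym (negbTE lNj) add0r.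
have [->|_] := eqVneq i l; last by rewrite scale0r.
by rewrite [j == l]eq_sym (negbTE lNj) scaler0.
Qed.

Lemma pmul_ptens u v r s :
  pmul (ptens u r) (ptens v s) = ptens (u * v * 'X_r) s.
Proof.
apply/ffunP=> l; rewrite pmulE !ptensE (bigD1 r) //= ptensE eqxx.
rewrite big1 => [|j jNr]; last by rewrite ptensE (negbTE jNr) mul0r.
by rewrite addr0; case: ifP => _; [rewrite mulrAC | rewrite mulr0].
Qed.

Lemma pmul_is_linearl b : linear (pmul^~ b).
Proof.
move=> e a a'; apply/ffunP=> l; rewrite paddE pscaleE !pmulE.
rewrite scalerAl -mulrDl; congr (_ * _).
rewrite scaler_sumr -big_split /=; apply: eq_bigr => r _.
by rewrite paddE pscaleE mulrDl scalerAl.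
Qed.

Lemma pmul_is_linearr a : linear (pmul a).
Proof.
move=> e b b'; apply/ffunP=> l; rewrite paddE pscaleE !pmulE.
by rewrite paddE pscaleE mulrDr scalerAr.
Qed.

Lemma pmulA a b c : pmul (pmul a b) c = pmul a (pmul b c).
Proof.
apply/ffunP=> l; rewrite 3!pmulE mulrA; congr (_ * _).
by rewrite mulr_sumr; apply: eq_bigr => r _; rewrite pmulE mulrA.
Qed.

Lemma pmulCA a b c : pmul (pmul a b) c = pmul (pmul b a) c.
Proof. by rewrite !pmulA; apply/ffunP=> l; rewrite !pmulE mulrCA. Qed.

Lemma pD_ptens i u j :
  pD i (ptens u j) = ptens ('X_i * mderiv i u) j + (i == j)%:R *: ptens u i.
Proof.
apply/ffunP=> l; rewrite pDE paddE pscaleE !ptensE.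
have [->|lNj] := eqVneq l j.
  by rewrite [j == i]eq_sym; case: eqP => // _; rewrite !scale0r.
rewrite mderiv0 mulr0 scaler0; have [->|_] := eqVneq i j.
  by rewrite (negbTE lNj) scaler0 addr0.
by rewrite scale0r addr0.
Qed.

Lemma pD_is_linear i : linear (pD i).
Proof.
move=> e a b; apply/ffunP=> l; rewrite paddE pscaleE !pDE paddE pscaleE.
rewrite mderivD mderivZ mulrDr !scalerDr -scalerAr !scalerA.
by rewrite [e * _]mulrC addrACA.
Qed.

Lemma pmul0l c : pmul 0 c = 0.
Proof.
apply/ffunP=> l; rewrite pmulE pzeroE big1 ?mul0r // => r _.
by rewrite pzeroE mul0r.
Qed.

Lemma pmul0r c : pmul c 0 = 0.
Proof. by apply/ffunP=> l; rewrite pmulE pzeroE mulr0. Qed.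

Lemma pD0 i : pD i 0 = 0.
Proof.
by apply/ffunP=> m; rewrite pDE pzeroE mderiv0 mulr0 scaler0 addr0.
Qed.

Lemma Wterm0 a b i j : a = 0 \/ b = 0 ->
  Wgen (pmul a (pD i b)) j - Wgen (pmul b (pD j a)) i = 0.
Proof. by case=> ->; rewrite pD0 pmul0l pmul0r !Wgen0 subrr. Qed.

Lemma Wbracket_supp (x y : Wperm k n) i j :
    (forall l, l != i -> x l = 0) -> (forall l, l != j -> y l = 0) ->
  Wbracket x y
  = Wgen (pmul (x i) (pD i (y j))) j - Wgen (pmul (y j) (pD j (x i))) i.
Proof.
move=> x0 y0; rewrite /Wbracket (bigD1 i) //= [X in X + _](bigD1 j) //=.
rewrite [X in _ + X + _]big1 => [|l lNj]; last first.
  by apply: Wterm0; right; apply: y0.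
rewrite addr0 [X in _ + X]big1 ?addr0 // => l lNi.
by apply: big1 => m _; apply: Wterm0; left; apply: x0.
Qed.

Lemma Wbracket_gen a b i j :
  Wbracket (Wgen a i) (Wgen b j)
  = Wgen (pmul a (pD i b)) j - Wgen (pmul b (pD j a)) i.
Proof.
have Wii c l : Wgen c l l = c by rewrite WgenE eqxx.
have W0 c l m : m != l -> Wgen c l m = 0 by move=> /negbTE ml; rewrite WgenE ml.
by rewrite (Wbracket_supp (W0 a i) (W0 b j)) (Wii a i) (Wii b j).
Qed.

End PermAlgebra.

(* Main.v *)
(** Each [D_i] is a derivation of the perm algebra [P_n], and the [D_i] commute.
    Put [T_x b = \sum_i x_i . D_i b]; then [[x, y]_j = T_x y_j - T_y x_j].
    In [T_x T_y - T_y T_x] the second-order terms cancel because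
    [(a . b) . c = (b . a) . c], and what remains is [T_[x, y]]: the bracket is
    the commutator of a left-symmetric product, hence satisfies Jacobi. *)
Require Import Defs.
From HB Require Import structures.
From mathcomp Require Import all_boot all_algebra.
From mathcomp Require Import mpoly.
Local Open Scope ring_scope.
Import GRing.Theory.

(** * Commuting derivations of an abstract perm algebra *)

Section PermDerivations.

Context {k : fieldType} {V : lmodType k} {I : finType}.
Variables (mul : V -> V -> V) (D : I -> V -> V).
Hypotheses (mul_linearl : forall b, linear (mul^~ b))
           (mul_linearr : forall a, linear (mul a))
           (mulA : forall a b c, mul (mul a b) c = mul a (mul b c))
           (mulCA : forall a b c, mul (mul a b) c = mul (mul b a) c)
           (D_linear : forall i, linear (D i))
           (D_mul : forall i a b, D i (mul a b) = mul (D i a) b + mul a (D i b))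
           (DC : forall i j a, D i (D j a) = D j (D i a)).
Implicit Types (a b : V) (x y z : {ffun I -> V}).

(** A named right multiplication can carry its own linear structure, so [linear_sum] and [linearB]
    also apply in the left factor. *)
Let rmul b a := mul a b.

HB.instance Definition _ a := GRing.isLinear.Build k V V *:%R (mul a)
  (mul_linearr a).

HB.instance Definition _ b := GRing.isLinear.Build k V V *:%R (rmul b)
  (mul_linearl b).

HB.instance Definition _ i := GRing.isLinear.Build k V V *:%R (D i)
  (D_linear i).

(** The operator [T_x]: the action of [\sum_i x_i D_i] on [V]. *)
Definition vderiv x a : V := \sum_i mul (x i) (D i a).

Lemma vderiv_linearr x : linear (vderiv x).
Proof.
move=> e a b; rewrite /vderiv scaler_sumr -big_split /=.
by apply: eq_bigr => i _; rewrite D_linear mul_linearr.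
Qed.

Lemma vderiv_linearl a : linear (vderiv^~ a).
Proof.
move=> e x y; rewrite /vderiv scaler_sumr -big_split /=.
by apply: eq_bigr => i _; rewrite !ffunE mul_linearl.
Qed.

HB.instance Definition _ x := GRing.isLinear.Build k V V *:%R (vderiv x)
  (vderiv_linearr x).

(** The Leibniz rule for [D i] on [y_j . D_j a] separates first-order from second-order terms. *)
Lemma vderiv_comp x y a :
  vderiv x (vderiv y a) =
  \sum_j mul (vderiv x (y j)) (D j a) +
  \sum_i \sum_j mul (x i) (mul (y j) (D i (D j a))).
Proof.
rewrite {2}/vderiv linear_sum [X in _ + X]exchange_big -big_split /=.
apply: eq_bigr => j _; rewrite -[mul (vderiv _ _) _]/(rmul _ _) linear_sum.
rewrite -big_split /=; apply: eq_bigr => i _.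
by rewrite D_mul linearD /= /rmul mulA.
Qed.

Definition vbracket x y : {ffun I -> V} :=
  [ffun j => vderiv x (y j) - vderiv y (x j)].

Lemma vderiv_bracket x y a :
  vderiv (vbracket x y) a = vderiv x (vderiv y a) - vderiv y (vderiv x a).
Proof.
rewrite !vderiv_comp [X in _ - (_ + X)]exchange_big /=.
(* The second-order part is symmetric in [x] and [y]: [DC] swaps the derivations, and the perm
   identity swaps [x i] and [y j] in front of a third factor. *)
have -> : \sum_i \sum_j mul (y j) (mul (x i) (D j (D i a)))
          = \sum_i \sum_j mul (x i) (mul (y j) (D i (D j a))).
  apply: eq_bigr => i _; apply: eq_bigr => j _.
  by rewrite DC -mulA mulCA mulA.
rewrite opprD addrACA subrr addr0 -sumrB; apply: eq_bigr => j _.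
by rewrite ffunE -![mul _ (D j a)]/(rmul _ _) linearB.
Qed.

Lemma vbracket_linearl z : linear (vbracket^~ z).
Proof.
move=> e x y; apply/ffunP=> j; rewrite !ffunE vderiv_linearl linearP /=.
by rewrite scalerBr opprD addrACA.
Qed.

Lemma vbracketC x y : vbracket x y = - vbracket y x.
Proof. by apply/ffunP=> j; rewrite !ffunE opprB. Qed.

Lemma vbracket_linearr x : linear (vbracket x).
Proof.
move=> e y z; rewrite 3!(vbracketC x) vbracket_linearl.
by rewrite opprD scalerN.
Qed.

Lemma vbracket_alternating x : vbracket x x = 0.
Proof. by apply/ffunP=> j; rewrite !ffunE subrr. Qed.

Lemma vbracket_jacobi x y z :
  vbracket x (vbracket y z) + vbracket y (vbracket z x)
  + vbracket z (vbracket x y) = 0.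
Proof.
have E u v w j : vbracket u (vbracket v w) j =
    vderiv u (vderiv v (w j)) - vderiv u (vderiv w (v j))
    - (vderiv v (vderiv w (u j)) - vderiv w (vderiv v (u j))).
  by rewrite [LHS]ffunE vderiv_bracket ffunE linearB.
apply/ffunP=> j; rewrite [LHS]ffunE ffunE !E [RHS]ffunE.
(* Of the twelve terms, each [T_u (T_v w_j)] with [u, v, w] a permutation of [x, y, z] occurs twice,
   with opposite signs. *)
rewrite !opprB [X in _ + X + _]addrC [X in X + _]addrACA !subrKA.
by rewrite addrACA !subrKA subrr.
Qed.

Lemma vbracket_is_lie : is_lie_bracket vbracket.
Proof.
split; [exact: vbracket_linearl | exact: vbracket_linearr |
        exact: vbracket_alternating | exact: vbracket_jacobi].
Qed.

End PermDerivations.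

(** * The operators [D_i] on [P_n] *)

Section WittPerm.

Context {k : fieldType} {n : nat}.
Implicit Types (a b : perm_space k n) (x y z : Wperm k n).

Lemma mulX_mderivX (i r : 'I_n) :
  'X_i * mderiv i 'X_r = (i == r)%:R *: 'X_r :> {mpoly k[n]}.
Proof.
rewrite mderivX mnm1E eq_sym; have [->|_] := eqVneq i r.
  (* Subtraction of exponents is truncated, so [submK] needs the divisibility supplied by
     [lepm_refl]. *)
  by rewrite !scale1r -mpolyXD addmC submK // lepm_refl.
by rewrite !scale0r mulr0.
Qed.

(** The map [u x x_r |-> u x_r] from [P_n] to [A] intertwines [D_i] with [x_i d_i]; the Kronecker
    term of [D_i] matches the derivative of [x_r]. *)
Lemma sum_pD i a :
  \sum_(r < n) pD i a r * 'X_r = 'X_i * mderiv i (\sum_(r < n) a r * 'X_r).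
Proof.
rewrite linear_sum mulr_sumr; apply: eq_bigr => r _.
rewrite pDE /= mderivM mulrDl mulrDr mulrA; congr (_ + _).
  by rewrite mulrA.
by rewrite -mulrA mulrCA mulX_mderivX -scalerAl scalerAr.
Qed.

(** By [pmulE], [a] acts on the coordinates of [b] through its image in [A], so this is the Leibniz
    rule of [x_i d_i], with the Kronecker term absorbed by [b]. *)
Lemma pD_pmul i a b : pD i (pmul a b) = pmul (pD i a) b + pmul a (pD i b).
Proof.
apply/ffunP=> l; rewrite paddE pDE !pmulE sum_pD pDE mderivM.
rewrite !mulrDr -scalerAr addrA mulrA; congr (_ + _ + _).
  by rewrite mulrA.
by rewrite -mulrA mulrCA.
Qed.

Lemma mulX_mderivC i j (p : {mpoly k[n]}) :
  'X_i * mderiv i ('X_j * mderiv j p) = 'X_j * mderiv j ('X_i * mderiv i p).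
Proof.
rewrite !mderivM !mulrDr !mulrA !mulX_mderivX (mderiv_comm i j).
rewrite ['X_j * 'X_i]mulrC; congr (_ + _).
(* The remaining first-order terms carry a Kronecker delta: they vanish unless [i = j], where both
   sides coincide. *)
by have [->|_] := eqVneq i j; rewrite ?eqxx // !scale0r !mul0r.
Qed.

(** On coordinate [l], [D_i] is [x_i d_i] shifted by the scalar [delta_il], so commutation reduces
    to that of the [x_i d_i]. *)
Lemma pDC i j a : pD i (pD j a) = pD j (pD i a).
Proof.
have pD2E i' j' l : pD i' (pD j' a) l =
    'X_i' * mderiv i' ('X_j' * mderiv j' (a l))
    + ((j' == l)%:R *: ('X_i' * mderiv i' (a l))
       + (i' == l)%:R *: ('X_j' * mderiv j' (a l)))
    + ((i' == l)%:R * (j' == l)%:R) *: a l.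
  rewrite (pDE i') (pDE j') mderivD mderivZ mulrDr scalerDr.
  by rewrite -scalerAr scalerA !addrA.
apply/ffunP=> l; apply: (etrans (pD2E i j l)).
apply: (etrans _ (esym (pD2E j i l))).
rewrite mulX_mderivC [(i == l)%:R * _]mulrC; congr (_ + _ + _).
exact: addrC.
Qed.

(** In the [D_j] component, the positive terms survive only when the inner index is [j], the
    negative ones only when the outer index is [j]. *)
Lemma WbracketE x y : Wbracket x y = vbracket (@pmul k n) (@pD k n) x y.
Proof.
apply/ffunP=> j; rewrite /Wbracket sum_ffunE [RHS]ffunE.
under eq_bigr => i _ do rewrite sum_ffunE.
have E i l : (Wgen (pmul (x i) (pD i (y l))) l
    - Wgen (pmul (y l) (pD l (x i))) i) j
  = (if j == l then pmul (x i) (pD i (y l)) else 0)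
    - (if j == i then pmul (y l) (pD l (x i)) else 0).
  by rewrite !ffunE.
under eq_bigr => i _ do (under eq_bigr => l _ do rewrite E; rewrite sumrB).
rewrite sumrB; congr (_ - _).
  apply: eq_bigr => i _.
  by rewrite -big_mkcond (big_pred1 j) // => l; rewrite eq_sym.
rewrite exchange_big /=.
apply: eq_bigr => i _.
by rewrite -big_mkcond (big_pred1 j) // => l; rewrite eq_sym.
Qed.

End WittPerm.

Theorem corollary7p5 (k : fieldType) (hk : [pchar k] =i pred0)
    (n : nat) (hn : (1 <= n)%N) :
  is_lie_bracket (@Wbracket k n).
Proof.
have [linl linr alt jac] := vbracket_is_lie (@pmul k n) (@pD k n)
  (@pmul_is_linearl k n) (@pmul_is_linearr k n) (@pmulA k n) (@pmulCA k n)
  (@pD_is_linear k n) pD_pmul pDC.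
split=> [v e x y|u e x y|u|u v w]; rewrite !WbracketE.
- exact: linl.
- exact: linr.
- exact: alt.
- exact: jac.
Qed.
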